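(* Let $G$ be a unicyclic graph with $n \ge 4$ vertices and maximum degree $\Delta \ge 3$, let $q=\lfloor \frac{n}{\Delta-1}\rfloor$, and let $f : [1,\infty) \to \mathbb{R}$ be a convex function. If $q=1$ or $n=2\Delta-2$, then $$ I_f(G) \le f(\Delta) + f(n-\Delta+1) + f(2) + (n-3) f(1). $$ If $q>1$ and $n\ne 2\Delta-2$, then $$ I_f(G) \le q f(\Delta) + f\big(n-q(\Delta-1)+1\big) + (n-q-1) f(1). $$ The inequalities are attained (i.e., equality holds in the respective case) if and only if $G \in \mathcal{K}_n^\Delta$.
   Context: All graphs are finite, connected, simple (no loops, no multiple edges) and have at least one edge. A unicyclic graph is a graph containing exactly one cycle. For a vertex $u$ of $G$, $d_u$ denotes its degree. For a function $f:[1,\infty)\to\mathbb{R}$, $I_f(G) = \sum_{u\in V(G)} f(d_u)$. For $n\ge 4$, $3\le\Delta\le n-1$ and $q=\lfloor \frac{n}{\Delta-1}\rfloor$, define the $n$-tuple $\mathbf{z}$ as follows. If $q=1$ or $n=2\Delta-2$, then $\mathbf{z}=(\Delta,\,n-\Delta+1,\,2,\,1,\dots,1)$ with $n-3$ entries equal to $1$ at the end. If $q\ge 2$ and $n\ne 2\Delta-2$, then $\mathbf{z}=(z_1,\dots,z_n)$ with $z_j=\Delta$ for $1\le j\le q$, $z_{q+1}=n-q(\Delta-1)+1$, and $z_j=1$ for $q+1<j\le n$. $\mathcal{K}_n^\Delta$ is the set of unicyclic graphs with $n$ vertices whose degree sequence (in non-increasing order) is $\mathbf{z}$.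
   Formalization: The claim that equality forces G to lie in K_n^Δ is stated only for strictly convex f, since it fails for merely convex f (e.g. f = 0, n = 5, Δ = 3, G a 4-cycle with a pendant vertex); the inequalities and ''G in K implies equality'' hold for all convex f. *)

(* Defs.v *)
From mathcomp Require Import all_boot all_order all_algebra.
From mathcomp Require Import interval_inference.
From mathcomp Require Import boolp classical_sets set_interval reals convex.

Set Implicit Arguments.
Unset Strict Implicit.
Unset Printing Implicit Defensive.

Import Order.TTheory GRing.Theory Num.Theory.

Local Open Scope ring_scope.
Local Open Scope convex_scope.

(** ** Finite simple graphs *)

Record simple_graph (T : finType) := SimpleGraph {
  adj :> rel T;
  adj_sym : symmetric adj;
  adj_irr : irreflexive adj
}.

Section Graphs.
Variables (T : finType) (G : simple_graph T).

Definition deg (u : T) : nat := #|[pred v | G u v]|.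

Definition max_degree : nat := (\max_(u : T) deg u)%N.

Definition graph_connected : Prop := forall u v : T, connect G u v.

(* A cycle is identified with its edge set, so that the rotations and the
   reversal of a cyclic sequence of vertices count as one and the same cycle.
   The edge between u and v is the pair [set u; v]. *)
Definition cycle_edges (s : seq T) : {set {set T}} :=
  [set:: [seq [set u; next s u]%SET | u <- s]]%SET.

Definition is_graph_cycle (C : {set {set T}}) : Prop :=
  exists s : seq T, [/\ (2 < size s)%N, ucycle G s & C = cycle_edges s].

Definition unicyclic : Prop :=
  graph_connected /\ exists! C : {set {set T}}, is_graph_cycle C.

Definition degree_sequence : seq nat := sort geq [seq deg u | u <- enum T].

Definition I_ (R : realType) (f : R -> R) : R := \sum_(u : T) f (deg u)%:R.

End Graphs.

(* The truncated subtractions are exact when 3 <= Delta <= n - 1. *)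
Definition zseq (n Delta : nat) : seq nat :=
  let q := (n %/ (Delta - 1))%N in
  if (q == 1)%N || (n == 2 * Delta - 2)%N
  then [:: Delta; (n - Delta + 1)%N; 2%N] ++ nseq (n - 3) 1%N
  else nseq q Delta ++ (n - q * (Delta - 1) + 1)%N :: nseq (n - q - 1) 1%N.

Definition in_K (n Delta : nat) (T : finType) (G : simple_graph T) : Prop :=
  [/\ unicyclic G, #|T| = n & degree_sequence G = zseq n Delta].

(** ** Convexity on [1, +oo[ *)

(* A function [1, +oo[ -> R is represented by a total function, of which only
   the values on [1, +oo[ matter. *)
Definition convex_from1 (R : realType) (f : R -> R) : Prop :=
  @convex_function R R^o [set` `[1, +oo[%R]%classic f.

(* convex_function with a strict inequality for x != y and 0 < t < 1. *)
Definition strictly_convex_from1 (R : realType) (f : R -> R) : Prop :=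
  forall t : {i01 R}, 0 < t%:num < 1 ->
  forall x y : R^o, 1 <= x -> 1 <= y -> x != y ->
  (f (x <| t |> y) : R^o) < (f x : R^o) <| t |> (f y : R^o).

(* Main.v *)
(** A parent map sends each vertex of the cycle to its successor and every other
    vertex to a neighbour closer to the cycle; its graph consists of all the
    edges. Hence the degrees sum to 2n, no vertex is isolated and at least
    three vertices have degree at least 2. With x_u = d_u - 1, the x_u sum to n
    and lie between 0 and Delta - 1, and x |-> f (x + 1) is, on the naturals, an
    affine function plus a combination, with the second differences as
    nonnegative weights, of the functions (x - k)_+ for k >= 1. It therefore
    suffices to bound each sum of (x_u - k)_+, which depends only on the number
    of u with x_u > k. If f is strictly convex all weights are positive, so
    equality fixes all these sums, and these determine the degree sequence. *)
Require Import Defs.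
From mathcomp Require Import all_boot all_order all_algebra.
From mathcomp Require Import reals.
From mathcomp Require Import interval_inference classical_sets unstable convex.
From mathcomp Require Import zify ring lra.

Import Order.TTheory GRing.Theory Num.Theory.
Local Open Scope ring_scope.

(** * Parent maps and degrees of unicyclic graphs *)

(** Take for [d] the distance to [s]: the second vertex of a shortest path is one step closer. *)
Lemma descent_to {T : finType} (e : rel T) (s : seq T) :
    (forall v, exists2 x, x \in s & connect e v x) ->
  exists d : T -> nat,
    forall v, v \notin s -> exists2 w, e v w & (d w < d v)%N.
Proof.
move=> Hs.
pose P v k := [exists p : k.-tuple T, path e v p && (last v p \in s)].
have PP v p : path e v p -> last v p \in s -> P v (size p).
  by move=> ep lp; apply/existsP; exists (in_tuple p); rewrite ep lp.
have exP v : exists k, P v k.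
  have [x xs /connectP[p ep xE]] := Hs v.
  by exists (size p); apply: PP; rewrite -?xE.
exists (fun v => ex_minn (exP v)) => v vs.
case: ex_minnP => k /existsP[[p /= /eqP sp] /andP[ep lp]] _.
case: p sp ep lp => [|w p] /= sp; first by rewrite (negPf vs).
move=> /andP[vw ep] lp; exists w => //.
case: ex_minnP => m _ /(_ _ (PP _ _ ep lp)).
by rewrite -sp.
Qed.

Lemma next_next_neq {T : eqType} (s : seq T) x :
  (2 < size s)%N -> uniq s -> x \in s -> next s (next s x) != x.
Proof.
move=> s2 us xs; have [i q defs] := rot_to xs.
rewrite -!(next_rot i us) defs.
have := us; have := s2; rewrite -(size_rot i) -(rot_uniq i) defs.
case: q {defs} => [//|y [//|z q]] _ /=; rewrite !inE !negb_or eqxx.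
move=> /andP[/and3P[xy xz xq] /andP[/andP[yz yq] _]].
by rewrite (eq_sym y x) (negPf xy) /= eqxx eq_sym.
Qed.

(* An edge that is not a parent edge would close up, together with a path of
   parent edges, to a cycle other than the given one. *)
Lemma unicyclic_parent {T : finType} (G : simple_graph T) :
  unicyclic G ->
  exists (pi : T -> T) (s : seq T),
    [/\ (2 < size s)%N /\ uniq s, {in s, pi =1 next s},
        forall v, pi (pi v) != v
      & forall u v, G u v = (pi u == v) || (pi v == u)].
Proof.
case=> conG [C [[s [s2 /andP[cs us] CE]] Cuniq]].
have [x0 x0s] : exists x, x \in s.
  by case: s s2 {cs us CE} => // x s; exists x; rewrite mem_head.
have [d dP] : exists d : T -> nat,
    forall v, v \notin s -> exists2 w, G v w & (d w < d v)%N.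
  by apply: descent_to => v; exists x0.
(* Off the cycle, [dP] makes [pick] succeed, so the default [v] is never taken. *)
pose pi v := if v \in s then next s v
             else odflt v [pick w | G v w && (d w < d v)%N].
have pis : {in s, pi =1 next s} by move=> v vs; rewrite /pi vs.
have piG v : G v (pi v).
  rewrite /pi; case: ifPn => vs; first exact: next_cycle.
  case: pickP => [w /andP[]//|no]; have [w vw dw] := dP v vs.
  by have := no w; rewrite vw dw.
have pid v : v \notin s -> (d (pi v) < d v)%N.
  move=> vs; rewrite /pi (negPf vs); case: pickP => [w /andP[]//|no].
  by have [w vw dw] := dP v vs; have := no w; rewrite vw dw.
have pi2 v : pi (pi v) != v.
  have [vs|vs] := boolP (v \in s).
    by rewrite !pis ?mem_next // next_next_neq.
  have [ws|ws] := boolP (pi v \in s).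
    by apply: contraNneq vs => <-; rewrite pis ?mem_next.
  have := ltn_trans (pid _ ws) (pid _ vs).
  by apply: contraTneq => ->; rewrite ltnn.
exists pi, s; split => // u v; apply/idP/orP; last first.
  by case=> /eqP <-; rewrite // adj_sym.
move=> uv; apply/orP; apply: contraT => nuv.
(* Parent edges alone connect all vertices: parents lead down to [s], and [s] is itself a cycle of
   parent edges. *)
pose H := [rel x y : T | (pi x == y) || (pi y == x)].
have Hsym : connect_sym H.
  by apply: sym_connect_sym => x y /=; rewrite orbC.
have HG x y : H x y -> G x y by case/orP => /eqP <-; rewrite // adj_sym.
have Hs x : x \in s -> connect H x x0.
  move=> xs; apply: (@connect_cycle _ H s) => //.
  apply: cycle_from_next => // y ys; by rewrite /= pis ?eqxx.
have Hx0 x : connect H x x0.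
  have [k] := ubnP (d x); elim: k x => // k IHk x dx.
  have [xs|xs] := boolP (x \in s); first exact: Hs.
  apply: (@connect_trans _ _ (pi x)); first by apply: connect1; rewrite /= eqxx.
  by apply: IHk; apply: leq_trans (pid _ xs) _.
have : connect H u v.
  by apply: connect_trans (Hx0 u) _; rewrite Hsym.
case/connectP => p0 Hp0 /esym.
case/shortenP: Hp0 => p Hp up _ lp.
have Cp : is_graph_cycle G (cycle_edges (u :: p)).
  exists (u :: p); split => //.
    (* With fewer than two edges on the path, [uv] would be a loop or a parent edge. *)
    case: p Hp {up} lp => [_ /= uE|w [|//]]; first by rewrite -uE adj_irr in uv.
    by rewrite /= andbT => Hw wE; rewrite wE (negPf nuv) in Hw.
  rewrite /ucycle up andbT /= rcons_path lp adj_sym uv andbT.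
  by apply: sub_path Hp => x y; exact: HG.
have : [set v; u]%SET \in C.
  rewrite (Cuniq _ Cp) inE; apply/mapP; exists v; first by rewrite -lp mem_last.
  congr [set v; _]%SET.
  (* [v] has index [size p] in [u :: p], so [next] reads past the end of [p] and returns the default
     [u]. *)
  by rewrite next_nth -{1}lp mem_last -lp (index_last up) nth_default.
(* As an edge of the given cycle, [uv] joins some [x] to [next s x = pi x], so it is a parent edge
   after all. *)
rewrite CE inE => /mapP[x xs /setP E].
have nxx : next s x != x.
  by have := piG x; rewrite pis //; apply: contraTneq => ->; rewrite adj_irr.
have := E (next s x); have := E x.
rewrite !inE !eqxx orbT /= -pis // => xE pixE.
move: nuv nxx; rewrite -pis //.
by case/orP: xE pixE => /eqP <- /orP[] ->; rewrite ?orbT.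
Qed.

(** The neighbours of a vertex are its parent and its children, and [pi (pi u) != u] keeps these
    apart. Each vertex is a child exactly once, which gives the sum. A vertex of the cycle has its
    predecessor as a child. *)
Lemma unicyclic_degree {T : finType} (G : simple_graph T) :
  unicyclic G ->
  [/\ (\sum_u deg G u = 2 * #|T|)%N, forall u, (0 < deg G u)%N
    & (2 < #|[pred u | 1 < deg G u]|)%N].
Proof.
case/unicyclic_parent => pi [s [[s2 us] pis pi2 GE]].
have degE u : deg G u = (1 + \sum_(v | pi v == u) 1)%N.
  rewrite /deg -sum1_card (bigD1 (pi u)) /=; last by rewrite inE GE eqxx.
  congr addn; apply: eq_bigl => v; rewrite inE GE.
  rewrite (eq_sym v); have [<-|_] := eqVneq (pi u) v; last by rewrite andbT.
  by rewrite andbF (negPf (pi2 u)).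
split.
- rewrite (eq_bigr _ (fun u _ => degE u)) big_split /= sum1_card mul2n -addnn.
  by congr addn; rewrite -sum1_card [RHS](partition_big pi predT).
- by move=> u; rewrite degE.
- apply: (leq_trans s2); rewrite -(card_uniqP us); apply: subset_leq_card.
  apply/fintype.subsetP => x xs; rewrite inE degE ltnS (bigD1 (prev s x)) //=.
  by rewrite pis ?mem_prev // next_prev.
Qed.

(** * Layer sums and Karamata's inequality on the naturals *)

(** A discrete Taylor formula; truncated subtraction provides the positive part. Terms with [x <= j]
    vanish, so one [N] can serve all entries of a sequence. *)
Lemma layer_sum {R : comPzRingType} (F : nat -> R) (N x : nat) : (x <= N)%N ->
  F x = F 0%N + (F 1%N - F 0%N) *+ x
        + \sum_(j < N) (F j.+2 - F j.+1 *+ 2 + F j) *+ (x - j.+1).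
Proof.
elim: x => [|x IHx] xN.
  by rewrite big1 => [|j _]; rewrite ?sub0n ?mulr0n ?addr0.
have tele : F x.+1 - F x =
    F 1%N - F 0%N + \sum_(j < x) (F j.+2 - F j.+1 *+ 2 + F j).
  elim: x {IHx xN} => [|x IHx]; first by rewrite big_ord0 addr0.
  by rewrite big_ord_recr /= addrA -IHx; ring.
(* Raising [x] by one raises the truncated difference by one exactly when [j < x]. *)
have step : \sum_(j < N) (F j.+2 - F j.+1 *+ 2 + F j) *+ (x.+1 - j.+1) =
    \sum_(j < N) (F j.+2 - F j.+1 *+ 2 + F j) *+ (x - j.+1) +
    \sum_(j < x) (F j.+2 - F j.+1 *+ 2 + F j).
  rewrite (big_ord_widen _ (fun j => F j.+2 - F j.+1 *+ 2 + F j) (ltnW xN)).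
  rewrite [X in _ = _ + X]big_mkcond -big_split; apply: eq_bigr => j _ /=.
  case: ltnP => jx; first by rewrite -mulrSr; congr (_ *+ _); lia.
  by rewrite addr0; congr (_ *+ _); lia.
rewrite -[LHS](subrK (F x)) tele [in LHS](IHx (ltnW xN)) step mulrSr; ring.
Qed.

(** The second difference in [k] of the truncated [x - k] is the indicator of a single positive
    value of [x]. The multiplicity of 0 then follows from the common size. *)
Lemma eq_layers_perm (a b : seq nat) : size a = size b ->
  (forall k, \sum_(x <- a) (x - k) = \sum_(x <- b) (x - k))%N -> perm_eq a b.
Proof.
move=> sab ab; apply/allP => v _; apply/eqP.
case: v => [|v].
  have E (s : seq nat) :
      (count_mem 0 s + \sum_(x <- s) (x - 0)
       = size s + \sum_(x <- s) (x - 1))%N.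
    rewrite -sum1_size -sum1_count big_mkcond -!big_split /=.
    by apply: eq_bigr => x _; case: (@eqP nat); lia.
  by have := E a; have := E b; rewrite !ab sab; lia.
have E (s : seq nat) : (count_mem v.+1 s + 2 * \sum_(x <- s) (x - v.+1)
    = \sum_(x <- s) (x - v) + \sum_(x <- s) (x - v.+2))%N.
  rewrite -sum1_count big_mkcond big_distrr -!big_split /=.
  by apply: eq_bigr => x _; case: (@eqP nat); lia.
by have := E a; have := E b; rewrite !ab; lia.
Qed.

Lemma excess_le_count (a : seq nat) D k : {in a, forall x, x <= D}%N ->
  (\sum_(x <- a) (x - k) <= count (ltn k) a * (D - k))%N.
Proof.
elim: a => [|x a IHa] aD; rewrite ?big_nil // big_cons /= mulnDl leq_add //.
  by have := aD x (mem_head x a); case: ltnP; lia.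
by apply: IHa => y ya; apply: aD; rewrite inE ya orbT.
Qed.

(** A positive entry not above [k] still uses up at least 1 of the total. *)
Lemma excess_count_le (a : seq nat) k :
  (\sum_(x <- a) (x - k) + count (ltn k) a * k + count (ltn 0) a
   <= \sum_(x <- a) x + count (ltn k) a)%N.
Proof.
elim: a => [|x a IHa]; rewrite ?big_nil // !big_cons /=.
by case: (ltnP k x) => kx; case: (ltnP 0 x) => x0; lia.
Qed.

(** After [layer_sum] the two sides differ only in their layers, weighted by the second differences
    of [F]. *)
Lemma karamata_nat {R : realDomainType} (F : nat -> R) (a b : seq nat) :
    (forall k, F k.+1 *+ 2 <= F k + F k.+2) ->
    size a = size b -> (\sum_(x <- a) x = \sum_(x <- b) x)%N ->
    (forall k, \sum_(x <- a) (x - k.+1) <= \sum_(x <- b) (x - k.+1))%N ->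
  \sum_(x <- a) F x <= \sum_(x <- b) F x
  /\ ((forall k, F k.+1 *+ 2 < F k + F k.+2) ->
      \sum_(x <- a) F x = \sum_(x <- b) F x -> perm_eq a b).
Proof.
move=> Fconv sab ab le_ab.
pose c j := F j.+2 - F j.+1 *+ 2 + F j.
have FE N s : (\sum_(x <- s) x <= N)%N -> \sum_(x <- s) F x =
    F 0%N *+ size s + (F 1%N - F 0%N) *+ (\sum_(x <- s) x)
    + \sum_(j < N) c j *+ (\sum_(x <- s) (x - j.+1)).
  move=> sN; under [X in _ = _ + X]eq_bigr do rewrite -sumrMnr.
  rewrite exchange_big /= -sumrMnr -sum1_size -sumrMnr -!big_split /=.
  apply: eq_big_seq => x xs; rewrite mulr1n; apply: layer_sum.
  by apply: leq_trans sN; rewrite (big_rem x xs) leq_addr.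
pose S := (\sum_(x <- b) x)%N.
have c_ge0 j : 0 <= c j by rewrite /c addrAC subr_ge0 addrC.
split=> [|Fsconv].
  rewrite (FE S a) ?(FE S b) ?ab // sab lerD2l.
  by apply: ler_sum => j _; rewrite ler_wpMn2l.
have c_gt0 j : 0 < c j by rewrite /c addrAC subr_gt0 addrC.
move=> E; apply: eq_layers_perm => // -[|k].
  by under eq_bigr do rewrite subn0; under [RHS]eq_bigr do rewrite subn0.
(* The number of layers must be at least [S], to bound all entries, and exceed [k], so that layer
   [k] occurs. *)
have ltk : (k < S + k.+1)%N by lia.
move: E; rewrite (FE (S + k.+1)%N a) ?(FE (S + k.+1)%N b) ?ab ?leq_addr // sab.
move/addrI/eqP; rewrite (leif_sum (C := fun j : 'I__ =>
  \sum_(x <- a) (x - j.+1) == \sum_(x <- b) (x - j.+1))%N) => [|j _].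
  by move/forallP/(_ (Ordinal ltk))/eqP.
by split; rewrite ?ler_wpMn2l // (inj_eq (mulrIn (lt0r_neq0 (c_gt0 j)))).
Qed.

(** * Convexity at consecutive naturals *)

Lemma midpoint_nat {R : realFieldType} (k : nat) :
  (1 / 2) * k.+1%:R + (1 - 1 / 2) * k.+3%:R = k.+2%:R :> R.
Proof. by rewrite -[k.+3]addn3 -[k.+2]addn2 -[k.+1]addn1 !natrD; lra. Qed.

Lemma half_ge0 {R : realFieldType} : 0 <= 1 / 2 :> R.
Proof. lra. Qed.

Lemma half_le1 {R : realFieldType} : 1 / 2 <= 1 :> R.
Proof. lra. Qed.

(** This is midpoint convexity; the shifted indices keep all three points in the domain, which
    starts at 1. *)
Lemma convex_from1_nat {R : realType} (f : R -> R) (k : nat) :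
  convex_from1 f -> f k.+2%:R *+ 2 <= f k.+1%:R + f k.+3%:R.
Proof.
move=> /(_ (Itv01 half_ge0 half_le1) k.+1%:R k.+3%:R).
rewrite !inE /= !in_itv /= !andbT !ler1n => /(_ isT isT).
rewrite [conv _ _ _](midpoint_nat k).
rewrite !convRE /= /onem; lra.
Qed.

Lemma strictly_convex_from1_nat {R : realType} (f : R -> R) (k : nat) :
  strictly_convex_from1 f -> f k.+2%:R *+ 2 < f k.+1%:R + f k.+3%:R.
Proof.
move=> /(_ (Itv01 half_ge0 half_le1)) /= H.
have /H {}H : 0 < (1 / 2 : R) < 1 by apply/andP; split; lra.
have := H k.+1%:R k.+3%:R; rewrite !ler1n eqr_nat => /(_ isT isT).
have -> : k.+1 != k.+3 by lia.
rewrite [conv _ _ _](midpoint_nat k).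
by move=> /(_ isT); rewrite !convRE /= /onem; lra.
Qed.

(** * The extremal sequence and its majorization property *)

Lemma zseqE {n Delta} :
  let q := (n %/ (Delta - 1))%N in
  (2 < Delta < n)%N ->
  (q = 1 \/ n = 2 * Delta - 2)%N /\ (n <= 2 * (Delta - 1))%N
    /\ zseq n Delta = [:: Delta; (n - Delta + 1)%N; 2%N] ++ nseq (n - 3) 1%N
  \/ (1 < q /\ n <> 2 * Delta - 2)%N /\ (q + 1 <= n)%N
    /\ zseq n Delta =
       nseq q Delta ++ (n %% (Delta - 1) + 1)%N :: nseq (n - q - 1) 1%N.
Proof.
move=> q Dn; rewrite /zseq -/q; have := divn_eq n (Delta - 1); rewrite -/q.
have : (n %% (Delta - 1) < Delta - 1)%N by rewrite ltn_mod; lia.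
have q0 : (0 < q)%N by rewrite divn_gt0; lia.
case: eqP => q1 /=; first by rewrite q1; left; split; [left|split; [lia|]].
case: eqP => nD /=; first by left; split; [right|split; [lia|]].
move=> r nE; right; split; [lia|split; [nia|]].
by rewrite {1}nE addKn.
Qed.

Lemma zseq_size n Delta : (2 < Delta < n)%N -> size (zseq n Delta) = n.
Proof.
move=> Dn; case: (zseqE Dn) => [[_ [h ->]]|[_ [h ->]]].
  by rewrite /= size_nseq; lia.
by rewrite size_cat /= !size_nseq; lia.
Qed.

Lemma zseq_gt0 n Delta : (2 < Delta < n)%N ->
  {in zseq n Delta, forall x, 0 < x}%N.
Proof.
move=> Dn; case: (zseqE Dn) => [[_ [h ->]]|[_ [h ->]]] x.
  by rewrite !inE mem_nseq => /or4P[/eqP|/eqP|/eqP|/andP[_ /eqP]] ->; lia.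
rewrite mem_cat inE !mem_nseq.
by move=> /or3P[/andP[_ /eqP]|/eqP|/andP[_ /eqP]] ->; lia.
Qed.

Lemma path_nseq {T : Type} (e : rel T) n x : e x x -> path e x (nseq n x).
Proof. by move=> exx; elim: n => //= n ->; rewrite exx. Qed.

Lemma zseq_sorted n Delta : (2 < Delta < n)%N -> sorted geq (zseq n Delta).
Proof.
move=> Dn; case: (zseqE Dn) => [[_ [h ->]]|[_ [h ->]]].
  rewrite /=; have -> : path geq 2%N (nseq (n - 3) 1%N).
    by case: (n - 3)%N => //= m; rewrite path_nseq.
  by apply/and3P; split; rewrite /geq /=; lia.
have tail x : (0 < x)%N -> path geq x (nseq (n - n %/ (Delta - 1) - 1) 1%N).
  by case: (_ - 1)%N => //= m x0; rewrite path_nseq ?andbT.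
have r : (n %% (Delta - 1) < Delta - 1)%N by rewrite ltn_mod; lia.
case: (n %/ _)%N tail => [|q] tail; first by rewrite /= tail ?addn1.
rewrite /= cat_path path_nseq //= tail ?addn1 // andbT.
have -> : last Delta (nseq q Delta) = Delta by elim: q {tail}.
by rewrite /geq /=; lia.
Qed.

Lemma zseq_pred_sum n Delta : (2 < Delta < n)%N ->
  (\sum_(x <- [seq y.-1 | y <- zseq n Delta]) x = n)%N.
Proof.
move=> Dn; rewrite big_map; case: (zseqE Dn) => [[_ [h ->]]|[_ [h ->]]].
  by rewrite /= !big_cons big_nseq iter_addn_0; lia.
rewrite big_cat big_cons /= !big_nseq !iter_addn_0.
rewrite {4}(divn_eq n (Delta - 1)); lia.
Qed.

(** Let [p] entries exceed [k.+1]. Their upper bound [Delta.-1] limits the excess when [p] is small;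
    the total [n] limits it when [p] is large. *)
Lemma zseq_majorizes n Delta (a : seq nat) k : (2 < Delta < n)%N ->
    (\sum_(x <- a) x = n)%N -> {in a, forall x, x <= Delta.-1}%N ->
    (2 < count (ltn 0) a)%N ->
  (\sum_(x <- a) (x - k.+1)
   <= \sum_(x <- [seq y.-1 | y <- zseq n Delta]) (x - k.+1))%N.
Proof.
move=> Dn an aD a2; rewrite big_map.
have := excess_le_count a _ k.+1 aD; have := excess_count_le a k.+1; rewrite an.
have : (count (ltn k.+1) a <= count (ltn 0) a)%N by apply: sub_count => -[].
move: (count (ltn k.+1) a) => p p0; set S := (\sum_(x <- a) _)%N => H1 H2.
have [Dk|kD] := leqP Delta.-1 k.+1.
  by move: H2; rewrite (eqP Dk) muln0; lia.
case: (zseqE Dn) => [[_ [h ->]]|[_ [h ->]]].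
  rewrite /= !big_cons big_nseq iter_addn_0.
  (* For two large entries, a third positive entry leaves them at most [n - 1]; this matches the
     entry 2 of [zseq]. *)
  case: p p0 H1 H2 => [|[|[|p]]] p0 H1 H2; [lia|lia|lia|].
  by have := leq_mul2r k 3 p.+3; rewrite mulnS in H1; lia.
rewrite big_cat big_cons /= !big_nseq !iter_addn_0.
have := divn_eq n (Delta - 1).
move: (n %/ (Delta - 1))%N h (n %% (Delta - 1))%N => q h r nE.
have [pq|qp] := leqP p q; first by rewrite subn1 in nE *; nia.
(* At least [q.+1] entries each lose [k.+1] from the total [n]. *)
have pS : (S + q.+1 * k.+1 <= n)%N.
  by have := leq_mul2r k.+1 q.+1 p; rewrite qp orbT; lia.
have DE : (Delta - 1 = (Delta.-1 - k.+1) + k.+1)%N by lia.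
by rewrite nE DE mulnDr mulSn [(q * (_ - _))%N]mulnC in pS; lia.
Qed.

(** * The bound for graphs and its equality case *)

Lemma I_degree_sequence {R : realType} {T : finType} (G : simple_graph T)
    (f : R -> R) :
  I_ G f = \sum_(x <- degree_sequence G) f x%:R.
Proof.
rewrite /degree_sequence (perm_big [seq deg G u | u <- enum T]) /=.
  by rewrite big_map big_enum.
exact/permPl/perm_sort.
Qed.

Lemma I_le_zseq {R : realType} {T : finType} (G : simple_graph T) (f : R -> R) :
  unicyclic G -> (2 < max_degree G < #|T|)%N -> convex_from1 f ->
  I_ G f <= \sum_(x <- zseq #|T| (max_degree G)) f x%:R
  /\ (strictly_convex_from1 f ->
      I_ G f = \sum_(x <- zseq #|T| (max_degree G)) f x%:R ->
      degree_sequence G = zseq #|T| (max_degree G)).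
Proof.
move=> uG Dn fconv; have [sumG degG cycG] := unicyclic_degree G uG.
set z := zseq _ _.
have zE : z = [seq x.+1 | x <- [seq y.-1 | y <- z]].
  rewrite -map_comp map_id_in // => x /(zseq_gt0 _ _ Dn) /=; lia.
have dE : [seq deg G u | u <- enum T] =
    [seq x.+1 | x <- [seq (deg G u).-1 | u <- enum T]].
  rewrite -map_comp; apply: eq_map => u /=; by have := degG u; lia.
have sumd : (\sum_(x <- [seq (deg G u).-1 | u <- enum T]) x = #|T|)%N.
  rewrite big_map big_enum /=; apply: (@addIn #|T|).
  rewrite -{1}sum1_card -big_split /= addnn -mul2n -sumG.
  by apply: eq_bigr => u _; have := degG u; lia.
have [] := karamata_nat (fun x => f x.+1%:R)
    [seq (deg G u).-1 | u <- enum T] [seq y.-1 | y <- z].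
- by move=> k; exact: convex_from1_nat.
- by rewrite size_map -cardT size_map zseq_size.
- by rewrite sumd zseq_pred_sum.
- move=> k; apply: zseq_majorizes => //.
    by move=> _ /mapP[u _ ->]; rewrite -!subn1 leq_sub2r //; exact: leq_bigmax.
  rewrite count_map; apply: (leq_trans cycG).
  rewrite -sum1_card -sum1_count big_enum_cond; apply/eq_leq/eq_bigl => u.
  by rewrite !inE /=; case: (deg G u).
have IE : I_ G f = \sum_(x <- [seq (deg G u).-1 | u <- enum T]) f x.+1%:R.
  rewrite big_map big_enum; apply: eq_bigr => u _; congr (f _%:R).
  by have := degG u; lia.
have zsumE : \sum_(x <- z) f x%:R = \sum_(x <- [seq y.-1 | y <- z]) f x.+1%:R.
  by rewrite {1}zE big_map.
rewrite -IE -zsumE => leI eqI; split=> // sconv IEz.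
have geq_anti : antisymmetric geq.
  by move=> x y /=; rewrite andbC => /anti_leq.
have geq_trans : transitive geq by move=> x y w /= xy /leq_trans; exact.
have geq_total : total geq by move=> x y; exact: leq_total.
(* Both sequences are sorted, so it suffices that they are permutations of each other. *)
apply: (sorted_eq geq_trans geq_anti); rewrite ?sort_sorted ?zseq_sorted //.
rewrite perm_sort dE zE perm_map //; apply: eqI => // k.
exact: strictly_convex_from1_nat.
Qed.

Theorem theorem4p4 (R : realType) (T : finType) (G : simple_graph T)
    (n Delta q : nat) (f : R -> R) :
  unicyclic G ->
  #|T| = n -> (4 <= n)%N ->
  max_degree G = Delta -> (3 <= Delta)%N ->
  q = (n %/ (Delta - 1))%N ->
  convex_from1 f ->
  let B1 := f Delta%:R + f (n%:R - Delta%:R + 1) + f 2 + (n%:R - 3) * f 1 in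
  let B2 := q%:R * f Delta%:R + f (n%:R - q%:R * (Delta%:R - 1) + 1)
            + (n%:R - q%:R - 1) * f 1 in
  (q = 1%N \/ n = (2 * Delta - 2)%N ->
     [/\ I_ G f <= B1,
         in_K n Delta G -> I_ G f = B1
       & strictly_convex_from1 f -> (I_ G f = B1 <-> in_K n Delta G)])
  /\
  ((1 < q)%N /\ n <> (2 * Delta - 2)%N ->
     [/\ I_ G f <= B2,
         in_K n Delta G -> I_ G f = B2
       & strictly_convex_from1 f -> (I_ G f = B2 <-> in_K n Delta G)]).
Proof.
move=> uG Tn n4 GD D3 qE fconv B1 B2.
have Dn : (2 < Delta < n)%N.
  (* No vertex is its own neighbour, so degrees are at most [n.-1]. *)
  rewrite D3 -GD; suff: (max_degree G <= n.-1)%N by lia.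
  apply/bigmax_leqP => u _; rewrite -Tn (cardD1 u) /=; apply: subset_leq_card.
  apply/fintype.subsetP => v; rewrite !inE => uv; rewrite andbT.
  by apply: contraTneq uv => ->; rewrite adj_irr.
have [leI eqI] : I_ G f <= \sum_(x <- zseq n Delta) f x%:R
  /\ (strictly_convex_from1 f ->
      I_ G f = \sum_(x <- zseq n Delta) f x%:R ->
      degree_sequence G = zseq n Delta).
  by rewrite -Tn -GD; apply: I_le_zseq; rewrite // Tn GD.
have concl B : B = \sum_(x <- zseq n Delta) f x%:R ->
    [/\ I_ G f <= B, in_K n Delta G -> I_ G f = B
      & strictly_convex_from1 f -> (I_ G f = B <-> in_K n Delta G)].
  move=> ->.
  have KI : in_K n Delta G -> I_ G f = \sum_(x <- zseq n Delta) f x%:R.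
    by case=> _ _ dz; rewrite I_degree_sequence dz.
  by split=> // sconv; split=> // /(eqI sconv).
split=> hyp; apply: concl.
  case: (zseqE Dn) => [[_ [h ->]]|[]]; last by rewrite -qE; lia.
  rewrite /= !big_cons big_nseq iter_addr_0 -(mulr_natl (f 1)) /B1 natrD.
  by rewrite !natrB ?addrA; [|lia..].
case: (zseqE Dn) => [[]|[_ [h ->]]]; first by rewrite -qE; lia.
rewrite big_cat big_cons /= !big_nseq !iter_addr_0 /B2 -qE.
(* Since [q * (Delta - 1) <= n], the remainder is an exact difference and casts to the real
   expression in [B2]. *)
have -> : (n %% (Delta - 1) + 1 = n - q * (Delta - 1) + 1)%N.
  by rewrite {2}(divn_eq n (Delta - 1)) -qE addKn.
rewrite -qE in h.
rewrite natrD !natrB ?natrM ?natrB //;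
  [|by rewrite ?qE ?leq_divM //; lia..].
rewrite -(mulr_natl (f 1)) -(mulr_natl (f _%:R)) -subnDA natrB // natrD.
by rewrite opprD !addrA.
Qed.
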